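(* Let $A$ be a Banach algebra with a right identity, and let $d: A \to A$ be a Jordan derivation. Then the following statements hold. (i) $\operatorname{ran}(A)$ is invariant under $d$, i.e. $d(\operatorname{ran}(A)) \subseteq \operatorname{ran}(A)$. (ii) If $d$ maps $A$ into $\operatorname{ran}(A)$, then $d$ is a derivation.
   Context: Banach algebras are over $\mathbb{C}$ and associative, and are not assumed to be commutative or unital. A right identity of $A$ is an element $e \in A$ with $ae = a$ for all $a \in A$. The right annihilator of $A$ is $\operatorname{ran}(A) = \{r \in A : ar = 0 \text{ for all } a \in A\}$. A linear map $d: A \to A$ (not assumed continuous) is a derivation if $d(ax) = d(a)x + a\,d(x)$ for all $a, x \in A$, and a Jordan derivation if $d(a^2) = d(a)a + a\,d(a)$ for all $a \in A$. *)

(* Defs.v *)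
From HB Require Import structures.
From mathcomp Require Import all_boot all_order all_algebra.
From mathcomp Require Import complex.
From mathcomp Require Import boolp classical_sets reals.
From mathcomp Require Import topology normedtype.

Set Implicit Arguments.
Unset Strict Implicit.
Unset Printing Implicit Defensive.

Import Order.TTheory GRing.Theory Num.Theory.
Import numFieldNormedType.Exports.

Local Open Scope classical_set_scope.
Local Open Scope ring_scope.

(* The ring structures of MathComp all have a unit, so the product of a
   (possibly non-unital) Banach algebra is taken from [Semigroup], whose
   operation is written [( x * y )%g]; no commutation or inverse is implied. *)
HB.mixin Record Semigroup_isBanachAlgebra (K : numFieldType) A
    & CompleteNormedModule K A & Semigroup A := {
  bmulDl : left_distributive (fun x y : A => (x * y)%g) +%R ;
  bmulDr : right_distributive (fun x y : A => (x * y)%g) +%R ;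
  bscaleAl : forall (k : K) (x y : A), k *: (x * y)%g = ((k *: x) * y)%g ;
  bscaleAr : forall (k : K) (x y : A), k *: (x * y)%g = (x * (k *: y))%g ;
  bnormM_le : forall x y : A, `|(x * y)%g| <= `|x| * `|y| }.

#[short(type="banachAlgType")]
HB.structure Definition BanachAlgebra (K : numFieldType) :=
  {A of CompleteNormedModule K A & Semigroup A
      & Semigroup_isBanachAlgebra K A}.

Section Definitions.
Context {K : numFieldType} {A : banachAlgType K}.

Definition right_identity (e : A) : Prop := forall a : A, (a * e)%g = a.

Definition jordan_derivation (d : {linear A -> A}) : Prop :=
  forall a : A, d (a * a)%g = (d a * a)%g + (a * d a)%g.

Definition derivation (d : {linear A -> A}) : Prop :=
  forall a x : A, d (a * x)%g = (d a * x)%g + (a * d x)%g.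

End Definitions.

Definition ran {K : numFieldType} (A : banachAlgType K) : set A :=
  [set r | forall a : A, (a * r)%g = 0].
Arguments ran {K} A _.

(* Main.v *)
(* Let e be a right identity. Linearizing the Jordan identity at (a, e) gives
   d(ea) = d(e)a + e d(a), with d(e) in ran(A); for a in ran(A) this reads
   e d(a) = 0, whence (i). For (ii), split a = ea + r with r = a - ea in ran(A):
   if A d(A) = 0, then d(eax) = d(e)ax = d(ea)x, and linearizing at (r, x), where
   xr = 0, gives d(rx) = d(r)x. *)
Require Import Defs.
From mathcomp Require Import all_boot all_order all_algebra.
From mathcomp Require Import complex.
From mathcomp Require Import boolp classical_sets reals.
From mathcomp Require Import topology normedtype.
Local Open Scope classical_set_scope.
Local Open Scope ring_scope.
Import GRing.Theory.

Section RightIdentity.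
Context {K : numFieldType} {A : banachAlgType K}.

Lemma bmul0r (x : A) : (x * (0 : A))%g = 0.
Proof. by apply: (addrI (x * (0 : A))%g); rewrite -bmulDr !addr0. Qed.

Lemma bmulNr (x y : A) : (x * (- y))%g = - (x * y)%g.
Proof. by apply: (addrI (x * y)%g); rewrite -bmulDr !subrr bmul0r. Qed.

Lemma jordan_linearized (d : {linear A -> A}) (a x : A) :
  jordan_derivation d ->
  d (a * x)%g + d (x * a)%g =
    ((d a * x)%g + (a * d x)%g) + ((d x * a)%g + (x * d a)%g).
Proof.
move=> hd; have := hd (a + x); rewrite linearD !bmulDl !bmulDr !linearD !hd.
set p := (d a * a)%g; set q := (a * d a)%g; set s := (d x * x)%g.
set t := (x * d x)%g => h.
(* Adding [p + q + s + t], the value of [d (a * a) + d (x * x)], makes both sides rearrangements of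
   those of [h]. *)
apply: (addIr (p + q + s + t)); move: h.
rewrite [LHS](AC (3 * (1 * 2)) ((3 * 4) * (1 * 2 * 5 * 6))) => ->.
by rewrite [LHS](AC ((2 * 2) * (2 * 2))
  (((2 * 6) * (3 * 7)) * (1 * 5 * 4 * 8))).
Qed.

Context {e : A} (he : right_identity e).

(** Associativity: [a r = (a e) r = a (e r)]. *)
Lemma ran_left_mul_id (r : A) : (e * r)%g = 0 -> ran A r.
Proof. by move=> er0 a; rewrite -(he a) -mulgA er0 bmul0r. Qed.

Lemma ran_sub_id (a : A) : ran A (a - (e * a)%g).
Proof. by move=> b; rewrite bmulDr bmulNr mulgA he subrr. Qed.

Context {d : {linear A -> A}} (hd : jordan_derivation d).

(** Since [e e = e], the Jordan identity at [e] reads [d e = d e + e (d e)]. *)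
Lemma jordan_id_ran : ran A (d e).
Proof.
apply: ran_left_mul_id; apply: (addrI (d e)).
by rewrite addr0 -{1}(he (d e)) -hd he.
Qed.

Lemma jordan_mul_id (a : A) : d (e * a)%g = (d e * a)%g + (e * d a)%g.
Proof.
apply: (addrI (d a)); rewrite -{1}(he a) jordan_linearized //.
by rewrite he jordan_id_ran addr0.
Qed.

Lemma jordan_ran (r : A) : ran A r -> ran A (d r).
Proof.
move=> hr; apply: ran_left_mul_id.
(* The zero is inserted as [(d e) r], so that [e (d r)] becomes [d (e r) = d 0]. *)
by rewrite -[LHS]add0r -(hr (d e)) -jordan_mul_id hr linear0.
Qed.

Lemma jordan_into_ran_derivation :
  (forall x, ran A (d x)) -> derivation d.
Proof.
move=> hr a x; rewrite hr addr0.
have [r -> xr0] : exists2 r, a = (e * a)%g + r & ran A r.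
  by exists (a - (e * a)%g); [rewrite addrC subrK | exact: ran_sub_id].
have d_e y : d (e * y)%g = (d e * y)%g by rewrite jordan_mul_id hr addr0.
have d_r : d (r * x)%g = (d r * x)%g.
  (* [r] in [ran A] kills [x r] and [(d x) r]; [d x] and [d r] in [ran A] kill [r (d x)] and
     [x (d r)]. *)
  by have := jordan_linearized d r x hd; rewrite !xr0 !hr linear0 !addr0.
by rewrite bmulDl !linearD bmulDl d_r -mulgA !d_e mulgA.
Qed.

End RightIdentity.

Theorem proposition2p1 (R : realType) (A : banachAlgType R[i])
    (hA : exists e : A, right_identity e)
    (d : {linear A -> A}) (hd : jordan_derivation d) :
  (d @` ran A `<=` ran A) /\
  (range d `<=` ran A -> derivation d).
Proof.
case: hA => e he; split=> [_ [r hr <-]|hran]; first exact: (jordan_ran he hd).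
by apply: (jordan_into_ran_derivation he hd) => x; apply: hran; exists x.
Qed.
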